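(* Let $M=\{d_1,\ldots,d_m\}$ be a combinatorial $3$-manifold with $n$ vertices that is the union of $m$ difference cycles $d_i=(a_i^0:a_i^1:a_i^2:a_i^3)$, $1\le i\le m$, on $n$ vertices, where $a_i^3\ge a_i^j$ for all $1\le i\le m$ and $0\le j\le 2$. For $k\ge 0$ define $M_k=\{d_{1,k},\ldots,d_{m,k}\}$, where $d_{i,k}=(a_i^0:a_i^1:a_i^2:a_i^3+k)$ is a difference cycle on $n+k$ vertices. Then $M_k$ is a combinatorial manifold for all $k\ge 0$ if and only if $a_i^3>a_i^0+a_i^1+a_i^2$ for all $1\le i\le m$.
   Context: For positive integers $a_0,\ldots,a_d$ with $n=\sum_{i=0}^d a_i$, the difference cycle $(a_0:\ldots:a_d)$ of dimension $d$ on $n$ vertices is the simplicial complex $\mathbb{Z}_n\langle 0,a_0,a_0+a_1,\ldots,\sum_{i=0}^{d-1}a_i\rangle$. This is the orbit of the $d$-simplex with vertices $0,a_0,\ldots,\sum_{i=0}^{d-1}a_i\in\mathbb{Z}_n$ under the cyclic group generated by $v\mapsto v+1\bmod n$. A set $\{d_1,\ldots,d_m\}$ of difference cycles on the same number of vertices denotes the union of these complexes. A combinatorial $d$-manifold is a pure $d$-dimensional abstract simplicial complex in which the link of every vertex is a triangulated $(d-1)$-sphere that is PL-homeomorphic to the boundary of the $d$-simplex. *)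

(* Defs.v *)
From mathcomp Require Import all_boot all_order all_algebra.
From mathcomp Require Import finmap reals.

Set Implicit Arguments.
Unset Strict Implicit.
Unset Printing Implicit Defensive.

Import GRing.Theory Num.Theory.

Local Open Scope nat_scope.
Local Open Scope ring_scope.
Local Open Scope fset_scope.

(** * Geometric simplicial complexes and PL maps

    A geometric simplex is given by its finite set of vertices, a geometric
    complex by the finite set of its simplices.  The empty simplex is allowed;
    its hull is empty. *)

Section Geometric.

Variables (R : realType) (V : lmodType R).
Implicit Types (s t : {fset V}) (G H : {fset {fset V}}) (x : V).

Definition barycentric s (w : V -> R) : Prop :=
  (forall v, v \in s -> 0 <= w v) /\ \sum_(v <- s) w v = 1.

Definition hull s x : Prop :=
  exists2 w : V -> R, barycentric s w & x = \sum_(v <- s) w v *: v.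

Definition affinely_independent s : Prop :=
  forall w : V -> R,
    \sum_(v <- s) w v = 0 -> \sum_(v <- s) w v *: v = 0 ->
    forall v, v \in s -> w v = 0.

Definition geometric_complex G : Prop :=
  [/\ forall s, s \in G -> affinely_independent s,
      forall s t, s \in G -> t `<=` s -> t \in G
    & forall s t x, s \in G -> t \in G ->
        hull s x -> hull t x -> hull (s `&` t) x].

Definition polyhedron G x : Prop := exists2 s, s \in G & hull s x.

Definition subdivision G' G : Prop :=
  [/\ geometric_complex G',
      forall x, polyhedron G' x <-> polyhedron G x
    & forall s, s \in G' ->
        exists2 t, t \in G & forall x, hull s x -> hull t x].

End Geometric.

Section PL.

Variables (R : realType) (V W : lmodType R).

Definition simplicial_map (G : {fset {fset V}}) (H : {fset {fset W}})
    (f : V -> W) : Prop :=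
  forall s, s \in G ->
    [fset f v | v in s] \in H /\
    (forall w : V -> R, barycentric s w ->
       f (\sum_(v <- s) w v *: v) = \sum_(v <- s) w v *: f v).

(* Only the values of f on the polyhedron of G are constrained.  Continuity is
   automatic: f is affine on each of the finitely many closed simplices of a
   subdivision. *)
Definition pl_map (G : {fset {fset V}}) (H : {fset {fset W}})
    (f : V -> W) : Prop :=
  exists G' H',
    [/\ subdivision G' G, subdivision H' H & simplicial_map G' H' f].

End PL.

Definition pl_homeomorphic (R : realType) (V W : lmodType R)
    (G : {fset {fset V}}) (H : {fset {fset W}}) : Prop :=
  exists (f : V -> W) (g : W -> V),
    [/\ pl_map G H f, pl_map H G g,
        forall x, polyhedron G x -> g (f x) = x
      & forall y, polyhedron H y -> f (g y) = y].

(** * Abstract simplicial complexes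

    The empty face belongs to every nonempty complex. *)

Section Abstract.

Variable T : finType.
Implicit Types (K : {set {set T}}) (v : T).

Definition simplicial_complex K : Prop :=
  forall s t : {set T}, s \in K -> t \subset s -> t \in K.

Definition facet K (s : {set T}) : bool := maxset [in K] s.

Definition pure (d : nat) K : Prop :=
  K != set0 /\ forall s, facet K s -> #|s| = d.+1.

Definition link K v : {set {set T}} :=
  [set s : {set T} | (v \notin s) && (v |: s \in K)].

Definition basis_vector (R : realType) v : {ffun T -> R^o} :=
  [ffun u => (u == v)%:R].

Definition realization (R : realType) K : {fset {fset {ffun T -> R^o}}} :=
  [fset [fset basis_vector R v | v in s] | s : {set T} in K].

End Abstract.

Definition simplex_boundary (d : nat) : {set {set 'I_d.+1}} :=
  [set s : {set 'I_d.+1} | s \proper [set: 'I_d.+1]].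

Definition combinatorial_manifold (R : realType) (d : nat) (T : finType)
    (K : {set {set T}}) : Prop :=
  [/\ simplicial_complex K, pure d K
    & forall v, [set v]%SET \in K ->
        pl_homeomorphic (realization R (link K v))
                        (realization R (simplex_boundary d))].

(** * Difference cycles *)

(* For a = [:: a_0; ...; a_d] the base simplex has as vertices the partial
   sums of a, without the total sum.  The definition is meant for positive
   entries with sumn a = n and 1 < n ('Z_n is not Z/nZ for n < 2). *)
Definition base_simplex (n : nat) (a : seq nat) : {set 'Z_n} :=
  [set (sumn (take i a))%:R | i : 'I_(size a)]%SET.

Definition difference_cycle (n : nat) (a : seq nat) : {set {set 'Z_n}} :=
  [set s : {set 'Z_n} |
    [exists x : 'Z_n, s \subset [set (v + x)%R | v in base_simplex n a]%SET]].

Definition cyclic_complex (n m : nat) (a0 a1 a2 a3 : 'I_m -> nat) :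
    {set {set 'Z_n}} :=
  \bigcup_(i < m) difference_cycle n [:: a0 i; a1 i; a2 i; a3 i].

(* Main.v *)
Require Import Defs.
From HB Require Import structures.
From mathcomp Require Import all_boot all_order all_algebra.
From mathcomp Require Import finmap reals zify ring lra.

(** Write s_i = a_i^0 + a_i^1 + a_i^2.  If 2 s_i < n for all i, the offsets
    occurring in the link of a vertex are determined by their signed residues, so
    all vertex links of all M_k are isomorphic to the link of 0 in M.  Otherwise
    choose i maximising s_i and k with n + k = 2 s_i =: N.  In the link of 0 in M_k
    the vertex N/2 stands for both s_i and -s_i; every face containing it lies
    either in [0, N/2] or in [N/2, N], and both kinds occur, so N/2 is a cut point
    of its star.  The boundary of the tetrahedron has no such point: a punctured
    neighbourhood of any of its points is connected. *)

Set Implicit Arguments.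
Unset Strict Implicit.
Unset Printing Implicit Defensive.

Import Order.TTheory GRing.Theory Num.Theory.

(** * Transport of PL homeomorphisms along vertex isomorphisms *)

Local Open Scope ring_scope.
Local Open Scope fset_scope.

(** The last difference of each cycle enters only through the modulus, so passing from M to M_k
    replaces Z_n by Z_(n+k) and keeps the simplices. A violated inequality at one index gives 2 s_i
    >= n, so the modulus N = 2 max s_i is reached with some k >= 0. Maximality keeps every offset in
    [0, N/2]; a difference of two offsets is then congruent to N/2 only if they are 0 and N/2, and
    this makes the star of N/2 split.

    Connectedness enters through signs of one real function: barycentric weight on one side of the
    cut point minus weight on the other side, carried to the boundary of the tetrahedron by the PL
    homeomorphism. There it is continuous and, near the image of the cut point, vanishes only at
    that image, so the intermediate value theorem forces a single sign; the two sides of the cut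
    point give both. The topological input is thus reduced to continuity of PL maps on polyhedra. *)

Lemma hull_vertex (R : realType) (V : lmodType R) (s : {fset V}) v : v \in s -> hull s v.
Proof.
move=> vs; exists (fun u => (u == v)%:R).
  split=> [u _|]; first exact: ler0n.
  rewrite (big_fsetD1 v) //= eqxx big_seq big1 ?addr0 // => u.
  by rewrite !inE => /andP[/negbTE-> _].
rewrite (big_fsetD1 v) //= eqxx scale1r big_seq big1 ?addr0 // => u.
by rewrite !inE => /andP[/negbTE-> _]; rewrite scale0r.
Qed.

Lemma pl_map_polyhedron (R : realType) (V1 V2 : lmodType R) (G1 : {fset {fset V1}})
    (G2 : {fset {fset V2}}) f x :
  pl_map G1 G2 f -> polyhedron G1 x -> polyhedron G2 (f x).
Proof.
move=> [G1' [G2' [[_ e1 _] [_ e2 _] fs]]] /e1[s sG1 [w bw ->]].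
have [fsG2 fw] := fs _ sG1; apply/e2; exists [fset f v | v in s] => //.
rewrite fw //; case: bw => w0 w1.
(* [f] may identify vertices of [s], so the weights over each fibre are added up. *)
pose c y := \sum_(v <- s | f v == y) w v.
have eqc (U : lmodType R) (F : V1 -> U) (F' : V2 -> U) : (forall v, F v = F' (f v)) ->
   \sum_(v <- s) w v *: F v = \sum_(y <- [fset f v | v in s]) c y *: F' y.
  move=> FF'; under [RHS]eq_bigr do rewrite scaler_suml.
  rewrite (exchange_big_dep xpredT) //=; apply: eq_big_seq => v vs.
  under eq_bigl do rewrite eq_sym.
  rewrite -big_filter (big_rem (f v)) /=; last first.
    by rewrite mem_filter eqxx /=; apply/imfsetP; exists v.
  rewrite FF' big_seq big1 ?addr0 // => y.
  rewrite mem_rem_uniq ?filter_uniq ?fset_uniq //.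
  by rewrite !inE mem_filter => /andP[/negbTE->].
exists c; last exact: (eqc _ f id).
split=> [y _|]; first by rewrite /c big_seq_cond; apply: sumr_ge0 => v /andP[/w0].
rewrite -w1; transitivity (\sum_(v <- s) w v *: (1 : R^o)).
  rewrite (eqc R^o (fun=> 1) (fun=> 1)) //.
  by apply: eq_bigr => y _; rewrite [RHS]mulr1.
by apply: eq_bigr => v _; rewrite [LHS]mulr1.
Qed.

Section Transport.

Variables (R : realType) (V V' : lmodType R).
Variables (L : {linear V -> V'}) (L' : {linear V' -> V}).
Implicit Types (s t : {fset V}) (G : {fset {fset V}}).

Let img s : {fset V'} := [fset L v | v in s].
Let img2 G : {fset {fset V'}} := [fset img s | s in G].

Lemma hull_fixed s x : {in s, cancel L L'} -> hull s x -> L' (L x) = x.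
Proof.
move=> Hs [w _ ->]; rewrite !linear_sum; apply: eq_big_seq => v vs.
by rewrite !linearZ /= Hs.
Qed.

Lemma sum_img (W : nmodType) s (F : V' -> W) : {in s, cancel L L'} ->
  \sum_(v <- img s) F v = \sum_(v <- s) F (L v).
Proof.
move=> Hs; rewrite big_imfset //= => u v us vs E.
by rewrite -(Hs u us) -(Hs v vs) E.
Qed.

Lemma hull_img s x : {in s, cancel L L'} -> hull s x -> hull (img s) (L x).
Proof.
move=> Hs [w [w0 w1] ->]; exists (w \o L').
  split; last by rewrite sum_img // -w1; apply: eq_big_seq => v vs /=; rewrite Hs.
  by move=> _ /imfsetP[v /= vs ->] /=; rewrite Hs //; apply: w0.
rewrite sum_img // linear_sum; apply: eq_big_seq => v vs /=.
by rewrite linearZ /= Hs.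
Qed.

Lemma hull_imgE s y : {in s, cancel L L'} -> hull (img s) y ->
  exists2 x, hull s x & y = L x.
Proof.
move=> Hs [w [w0 w1] ->]; exists (\sum_(v <- s) w (L v) *: v).
  exists (w \o L) => //; split; last by rewrite -w1 sum_img.
  by move=> v vs /=; apply: w0; apply/imfsetP; exists v.
rewrite sum_img // linear_sum; apply: eq_big_seq => v vs /=.
by rewrite linearZ.
Qed.

Lemma img_sub s (t : {fset V'}) : {in s, cancel L L'} -> t `<=` img s ->
  exists2 s0, s0 `<=` s & t = img s0.
Proof.
move=> Hs ts; exists [fset v in s | L v \in t].
  by apply/fsubsetP => v; rewrite !inE /= => /andP[].
apply/fsetP => y; apply/idP/imfsetP => [yt|[v /=]]; last first.
  by rewrite !inE /= => /andP[_ vt] ->.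
have /imfsetP[v /= vs yE] := fsubsetP ts _ yt.
by exists v => //=; rewrite !inE /= vs -yE.
Qed.

(** Injectivity of [L] is demanded at vertices only; by linearity [L'] then inverts [L] on the whole
    polyhedron, although the ambient spaces may differ in dimension. *)
Definition cancel_on G := forall s, s \in G -> {in s, cancel L L'}.

Lemma polyhedron_img G y : cancel_on G ->
  polyhedron (img2 G) y <-> exists2 x, polyhedron G x & y = L x.
Proof.
move=> HG; split=> [[_ /imfsetP[s /= sG ->]] /(hull_imgE (HG _ sG))[x sx ->]|].
  by exists x => //; exists s.
move=> [x [s sG sx] ->]; exists (img s); first by apply/imfsetP; exists s.
exact: hull_img (HG _ sG) sx.
Qed.

Lemma polyhedron_fixed G x : cancel_on G -> polyhedron G x -> L' (L x) = x.
Proof. by move=> HG [s sG]; apply: hull_fixed; apply: HG. Qed.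

Lemma geometric_complex_img G : cancel_on G -> geometric_complex G ->
  geometric_complex (img2 G).
Proof.
move=> HG [aff sub int]; split.
- move=> _ /imfsetP[s /= sG ->] w; have Hs := HG _ sG.
  rewrite !sum_img // => w0 w1 _ /imfsetP[v /= vs ->].
  apply: (aff s sG (w \o L)) => //=.
  transitivity (L' (\sum_(v <- s) w (L v) *: L v)); last by rewrite w1 linear0.
  rewrite linear_sum; apply: eq_big_seq => u us /=.
  by rewrite linearZ /= Hs.
- move=> _ t /imfsetP[s /= sG ->] /(img_sub (HG _ sG))[s0 s0s ->].
  by apply/imfsetP; exists s0 => //=; apply: sub s0s.
- move=> _ _ y /imfsetP[s /= sG ->] /imfsetP[t /= tG ->].
  have Hs := HG _ sG; have Ht := HG _ tG.
  move=> /hull_imgE-/(_ Hs)[x sx ->] /hull_imgE-/(_ Ht)[x' tx' E].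
  have Ex : x' = x.
    by rewrite -(hull_fixed Hs sx) -(hull_fixed Ht tx') E.
  subst x'.
  have -> : img s `&` img t = img (s `&` t).
    apply/fsetP => z; rewrite inE; apply/andP/imfsetP => [[]|[v /=]].
      move=> /imfsetP[u /= us ->] /imfsetP[v /= vt] E'.
      exists u => //=; rewrite inE us /=.
      by rewrite -(Hs u us) E' Ht.
    by rewrite inE => /andP[vs vt] ->; split; apply/imfsetP; exists v.
  apply: hull_img; last exact: int.
  by move=> v; rewrite inE => /andP[/Hs].
Qed.

(** The new vertices of a subdivision are points of the polyhedron of [G], where [L'] already
    inverts [L]. *)
Lemma cancel_on_subdivision G G' : cancel_on G -> subdivision G' G -> cancel_on G'.
Proof.
move=> HG [_ GG' _] s sG' v vs; apply: (polyhedron_fixed HG).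
by apply/GG'; exists s => //; apply: hull_vertex.
Qed.

Lemma subdivision_img G G' : cancel_on G -> subdivision G' G ->
  subdivision (img2 G') (img2 G).
Proof.
move=> HG sub; have HG' := cancel_on_subdivision HG sub.
case: sub => geo pol car; split; first exact: geometric_complex_img.
  move=> y; split=> /polyhedron_img[//|x /pol Gx ->]; apply/polyhedron_img => //;
  by exists x.
move=> _ /imfsetP[s /= sG' ->]; have [t tG st] := car _ sG'.
exists (img t); first by apply/imfsetP; exists t.
move=> y /(hull_imgE (HG' _ sG'))[x sx ->].
by apply: hull_img (HG _ tG) _; apply: st.
Qed.

Variables (W : lmodType R) (H : {fset {fset W}}).

Lemma pl_map_img_dom G (f : V -> W) : cancel_on G -> pl_map G H f ->
  pl_map (img2 G) H (f \o L').
Proof.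
move=> HG [G' [H' [sG sH fs]]]; exists (img2 G'), H'; split=> //.
  exact: subdivision_img.
have HG' := cancel_on_subdivision HG sG.
move=> _ /imfsetP[s /= sG' ->]; have Hs := HG' _ sG'; have [fsH fw] := fs _ sG'.
split.
  suff -> : [fset (f \o L') v | v in img s] = [fset f v | v in s] by [].
  apply/fsetP => y; apply/imfsetP/imfsetP => [[_ /= /imfsetP[v /= vs ->] ->]|[v /= vs ->]].
    by exists v => //=; rewrite Hs.
  by exists (L v) => /=; [apply/imfsetP; exists v|rewrite Hs].
move=> w [w0 w1] /=; rewrite linear_sum !sum_img //.
have bw : barycentric s (w \o L).
  split=> [v vs /=|]; first by apply: w0; apply/imfsetP; exists v.
  by rewrite -w1 sum_img.
have /= := fw _ bw.
rewrite [in X in _ -> _ = X](_ : \sum_(i <- s) _ = \sum_(i <- s) w (L i) *: f i).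
  move=> <-; congr f; apply: eq_big_seq => v vs; by rewrite linearZ /= Hs.
by apply: eq_big_seq => v vs; rewrite Hs.
Qed.

Lemma pl_map_img_codom G (g : W -> V) : cancel_on G -> pl_map H G g ->
  pl_map H (img2 G) (L \o g).
Proof.
move=> HG [H' [G' [sH sG gs]]]; exists H', (img2 G'); split=> //.
  exact: subdivision_img.
have HG' := cancel_on_subdivision HG sG.
move=> s sH'; have [gsG gw] := gs _ sH'; split.
  rewrite (_ : [fset _ | v in s] = img [fset g v | v in s]).
    by apply/imfsetP; eexists; first exact: gsG.
  apply/fsetP => y; apply/imfsetP/imfsetP => [[v /= vs ->]|[_ /= /imfsetP[v /= vs ->] ->]].
    by exists (g v) => //=; apply/imfsetP; exists v.
  by exists v.
move=> w bw /=; rewrite gw // linear_sum; apply: eq_bigr => v _.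
by rewrite linearZ.
Qed.

Lemma pl_homeomorphic_img G : cancel_on G -> pl_homeomorphic G H ->
  pl_homeomorphic (img2 G) H.
Proof.
move=> HG [f [g [plf plg gf fg]]]; exists (f \o L'), (L \o g); split.
- exact: pl_map_img_dom.
- exact: pl_map_img_codom.
- move=> y /polyhedron_img[//|x Gx ->] /=.
  by rewrite (polyhedron_fixed HG Gx) gf.
- move=> y Hy /=; have Gy := pl_map_polyhedron plg Hy.
  by rewrite (polyhedron_fixed HG Gy) fg.
Qed.

End Transport.

Section Pushforward.

Variables (R : realType) (T T' : finType) (f : T -> T').

(** The linear extension of the vertex map [f]: in barycentric coordinates, the simplicial map that
    [f] induces. *)
Definition pushforward (x : {ffun T -> R^o}) : {ffun T' -> R^o} :=
  [ffun y => \sum_(u | f u == y) x u].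

Lemma pushforward_linear : linear pushforward.
Proof.
move=> a x y; apply/ffunP => z; rewrite !ffunE scaler_sumr -big_split /=.
by apply: eq_bigr => u _; rewrite !ffunE.
Qed.

HB.instance Definition _ :=
  GRing.isLinear.Build R {ffun T -> R^o} {ffun T' -> R^o} _ pushforward pushforward_linear.

Lemma pushforward_basis v : pushforward (basis_vector R v) = basis_vector R (f v).
Proof.
apply/ffunP => y; rewrite !ffunE.
under eq_bigr do rewrite ffunE.
have [->|yfv] := eqVneq y (f v).
  by rewrite (bigD1 v) //= eqxx big1 ?addr0 // => u /andP[_ /negbTE->].
apply: big1 => u /eqP fu; case: eqP => // uv.
by rewrite -fu uv eqxx in yfv.
Qed.

End Pushforward.

(** The vertex maps are inverse to each other only on vertices of faces: the intended types ['Z_N]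
    and ['Z_N'] have different cardinalities, while the links in them are isomorphic. *)
Lemma pl_homeomorphic_iso (R : realType) (T T' : finType) (K : {set {set T}})
    (K' : {set {set T'}}) (f : T -> T') (g : T' -> T)
    (W : lmodType R) (H : {fset {fset W}}) :
  (forall s : {set T}, s \in K -> f @: s \in K') ->
  (forall s : {set T'}, s \in K' -> g @: s \in K) ->
  (forall s v, s \in K -> v \in s -> g (f v) = v) ->
  (forall s v, s \in K' -> v \in s -> f (g v) = v) ->
  pl_homeomorphic (realization R K) H -> pl_homeomorphic (realization R K') H.
Proof.
move=> fK gK gf fg KH.
suff -> : realization R K' =
    [fset [fset @pushforward R _ _ f v | v in s] | s : {fset {ffun T -> R^o}} in realization R K].
  apply: (pl_homeomorphic_img (L' := @pushforward R _ _ g)) KH.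
  move=> _ /imfsetP[s /= sK ->] _ /imfsetP[v /= vs ->].
  by rewrite !pushforward_basis (gf s).
have bE (s : {set T}) : [fset basis_vector R v | v in f @: s] =
    [fset @pushforward R _ _ f v | v in [fset basis_vector R v | v in s]].
  apply/fsetP => y; apply/imfsetP/imfsetP.
    move=> [_ /= /imsetP[v vs ->] ->]; exists (basis_vector R v) => /=.
      by apply/imfsetP; exists v.
    by rewrite pushforward_basis.
  move=> [_ /= /imfsetP[v /= vs ->] ->]; exists (f v) => /=; first exact: imset_f.
  by rewrite pushforward_basis.
apply/fsetP => S; apply/imfsetP/imfsetP.
  move=> [s /= sK' ->]; exists [fset basis_vector R v | v in g @: s] => /=.
    by apply/imfsetP; exists (g @: s); rewrite //= gK.
  suff sE : f @: (g @: s) = s by rewrite -bE sE.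
  rewrite -imset_comp -[RHS]imset_id; apply: eq_in_imset => v vs /=.
  by rewrite (fg s).
move=> [_ /= /imfsetP[s /= sK ->] ->]; exists (f @: s); rewrite ?fK //.
Qed.

Local Close Scope fset_scope.
Local Close Scope ring_scope.

(** * Links in unions of difference cycles *)

Local Open Scope nat_scope.

Lemma Zp_nat_inj N c b : c < N -> b < N -> (c%:R : 'Z_N)%R = b%:R%R -> c = b.
Proof.
case: N => [|[|N]] //; first by case: c; case: b.
by move=> cN bN /(congr1 val); rewrite /= !val_Zp_nat // !modn_small.
Qed.

Section CyclicComplex.

Variables (m : nat) (a0 a1 a2 : 'I_m -> nat).

(** The vertices of the base simplex before reduction modulo [N], which makes them comparable across
    moduli. *)
Definition offsets i : seq nat :=
  [:: 0; a0 i; a0 i + a1 i; a0 i + a1 i + a2 i].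

Lemma offsets_le i c : c \in offsets i -> c <= a0 i + a1 i + a2 i.
Proof. by rewrite !inE => /or4P[] /eqP->; lia. Qed.

Lemma in_base_simplex N i e (v : 'Z_N) :
  reflect (exists2 c, c \in offsets i & v = c%:R%R)
          (v \in base_simplex N [:: a0 i; a1 i; a2 i; e]).
Proof.
apply: (iffP imsetP) => [[[j jlt] _ ->]|[c co ->]].
  exists (nth 0 (offsets i) j); first exact: mem_nth.
  by move: j jlt => [|[|[|[|j]]]] //= _; rewrite ?addn0 ?addnA.
have jlt : index c (offsets i) < 4 by rewrite index_mem.
move: (nth_index 0 co) jlt; move: (index _ _) => j <- jlt.
exists (Ordinal jlt) => //=.
by move: j jlt; do 4?[case; first by rewrite /= ?addn0 ?addnA].
Qed.

Variable a3 : 'I_m -> nat.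

Lemma cyclic_complexP N (s : {set 'Z_N}) :
  reflect (exists i (x : 'Z_N), forall u, u \in s ->
             exists2 c, c \in offsets i & u = (c%:R + x)%R)
          (s \in cyclic_complex N a0 a1 a2 a3).
Proof.
apply: (iffP bigcupP) => [[i _]|[i [x H]]].
  rewrite inE => /existsP[x /subsetP sub]; exists i, x => u /sub/imsetP[v].
  by move=> /in_base_simplex[c co ->] ->; exists c.
exists i => //; rewrite inE; apply/existsP; exists x; apply/subsetP => u /H[c co ->].
by apply: imset_f; apply/in_base_simplex; exists c.
Qed.

Lemma cyclic_complex_closed N : simplicial_complex (cyclic_complex N a0 a1 a2 a3).
Proof.
move=> s t /cyclic_complexP[i [x H]] /subsetP ts; apply/cyclic_complexP.
by exists i, x => u /ts/H.
Qed.

(** A translate of the base simplex that contains [v] has [v] at some offset [b]; its vertex at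
    offset [c] is then [v + c - b]. *)
Lemma linkP N v (s : {set 'Z_N}) :
  reflect (v \notin s /\ exists i, exists2 b, b \in offsets i &
             forall u, u \in s -> exists2 c, c \in offsets i & u = (v + c%:R - b%:R)%R)
          (s \in link (cyclic_complex N a0 a1 a2 a3) v).
Proof.
rewrite inE; apply: (iffP andP) => [[vs vK]|[vs [i [b bo H]]]]; split=> //.
  move: vK => /cyclic_complexP[i [x H]]; have [b bo ->] := H v (setU11 _ _).
  exists i, b => // u us; have [c co ->] := H u (setU1r _ us).
  by exists c => //; ring.
apply/cyclic_complexP; exists i, (v - b%:R)%R => u /setU1P[->|/H[c co ->]].
  by exists b => //; rewrite addrC subrK.
by exists c => //; rewrite addrCA addrA.
Qed.

Hypothesis a_gt0 : forall i, [/\ 0 < a0 i, 0 < a1 i & 0 < a2 i].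

(** Every face lies in a full translate of a base simplex, and its four offsets, all below [N],
    remain distinct modulo [N]. *)
Lemma cyclic_complex_pure N (i0 : 'I_m) : (forall i, a0 i + a1 i + a2 i < N) ->
  pure 3 (cyclic_complex N a0 a1 a2 a3).
Proof.
move=> sN; split.
  apply/set0Pn; exists set0; apply/cyclic_complexP; exists i0, 0%R => u.
  by rewrite inE.
move=> s /maxsetP[/cyclic_complexP[i [x H]] smax].
pose t := [set (c%:R + x : 'Z_N)%R |
  c : 'I_(a0 i + a1 i + a2 i).+1 in [pred c : 'I__ | (c : nat) \in offsets i]].
have -> : s = t.
  apply/esym/smax; last first.
    apply/subsetP => u /H[c co ->]; apply/imsetP.
    by exists (Ordinal (offsets_le co : c < _.+1)).
  apply/cyclic_complexP; exists i, x => _ /imsetP[c cP ->]; by exists (c : nat).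
rewrite card_in_imset => [|c c' _ _ /addIr E]; last first.
  by apply/val_inj/(Zp_nat_inj _ _ E); apply: leq_ltn_trans (sN i); rewrite -ltnS.
rewrite -[4]/(size (offsets i)) -(size_map (inord : nat -> 'I_(a0 i + a1 i + a2 i).+1)).
have inv c : c \in offsets i -> (inord c : 'I_(a0 i + a1 i + a2 i).+1) = c :> nat.
  by move=> /offsets_le; rewrite -ltnS; apply: inordK.
have ui : uniq [seq (inord c : 'I_(a0 i + a1 i + a2 i).+1) | c <- offsets i].
  rewrite map_inj_in_uniq.
    by have [] := a_gt0 i; rewrite /= !inE; lia.
  by move=> c c' /inv cE /inv c'E E; rewrite -cE E.
rewrite -(card_uniqP ui); apply: eq_card => c; rewrite inE.
apply/idP/mapP => [cP|[c' c'o ->]]; last by rewrite inv.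
by exists (c : nat) => //; rewrite inord_val.
Qed.

(** * Independence of the links from the modulus *)

Section LinkIso.

Variables (N N' : nat).
Hypothesis N1 : 1 < N.

(* [u - v] is replaced by its representative in [-N/2, N/2). *)
Definition shift_residue (v : 'Z_N) (v' : 'Z_N') (u : 'Z_N) : 'Z_N' :=
  if 2 * (u - v)%R < N then (v' + (nat_of_ord (u - v))%:R)%R
  else (v' - (nat_of_ord (v - u))%:R)%R.

(** Both offsets are below N/2, so [c - b] lies strictly between -N/2 and N/2 and is its own signed
    residue. If it is negative, its representative [N - (b - c)] exceeds N/2, which selects the
    second branch. *)
Lemma shift_residueE v v' b c : 2 * b < N -> 2 * c < N ->
  shift_residue v v' (v + c%:R - b%:R)%R = (v' + c%:R - b%:R)%R.
Proof.
move=> bN cN.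
have nb e : 2 * e < N -> nat_of_ord (e%:R : 'Z_N)%R = e.
  by move=> eN; rewrite /= val_Zp_nat // modn_small //; lia.
have [bc|cb] := leqP b c.
  have E : (v + c%:R - b%:R - v = (c - b)%:R :> 'Z_N)%R.
    by rewrite natrB //; ring.
  rewrite /shift_residue E nb; last by lia.
  by rewrite natrB // addrA ifT //; lia.
have E : (v - (v + c%:R - b%:R) = (b - c)%:R :> 'Z_N)%R.
  by rewrite natrB 1?ltnW //; ring.
rewrite /shift_residue E nb; last by lia.
rewrite ifF; first by rewrite natrB 1?ltnW //; ring.
have -> : (v + c%:R - b%:R - v = - (b - c)%:R :> 'Z_N)%R by rewrite -E opprB.
have bcN : 2 * (b - c) < N by lia.
have -> : nat_of_ord (- (b - c)%:R : 'Z_N)%R = N - (b - c).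
  move: (nb _ bcN); case: N N1 bcN {E} => [|[|N0]] // _ bcN /= ->.
  by rewrite -[(Zp_trunc _).+2]/N0.+2 modn_small; lia.
lia.
Qed.

End LinkIso.

Lemma shift_residue_link N N' (v : 'Z_N) (v' : 'Z_N') (s : {set 'Z_N}) : 1 < N ->
    (forall i, 2 * (a0 i + a1 i + a2 i) < N) ->
    (forall i, 2 * (a0 i + a1 i + a2 i) < N') ->
    s \in link (cyclic_complex N a0 a1 a2 a3) v ->
  shift_residue v v' @: s \in link (cyclic_complex N' a0 a1 a2 a3) v'.
Proof.
move=> N1 sN sN' /linkP[vs [i [b bo H]]].
have bN : 2 * b < N by have := sN i; have := offsets_le bo; lia.
apply/linkP; split.
  apply/imsetP => -[u us]; have [c co uE] := H u us.
  have cN : 2 * c < N by have := sN i; have := offsets_le co; lia.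
  rewrite uE shift_residueE // => E; case/negP: vs.
  (* If [u] were sent to [v'], the offsets would agree modulo [N'], hence as numbers, and [u] would
     be [v] itself. *)
  suff bc : b = c by move: us; rewrite uE bc addrK.
  apply: (@Zp_nat_inj N'); [by have := sN' i; have := offsets_le bo; lia|
    by have := sN' i; have := offsets_le co; lia|].
  by apply: (addrI v'); rewrite {1}E addrNK.
exists i, b => // _ /imsetP[u us ->]; have [c co ->] := H u us; exists c => //.
by rewrite shift_residueE //; have := sN i; have := offsets_le co; lia.
Qed.

Lemma shift_residueK N N' (v : 'Z_N) (v' : 'Z_N') (s : {set 'Z_N}) u : 1 < N -> 1 < N' ->
    (forall i, 2 * (a0 i + a1 i + a2 i) < N) ->
    (forall i, 2 * (a0 i + a1 i + a2 i) < N') ->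
    s \in link (cyclic_complex N a0 a1 a2 a3) v -> u \in s ->
  shift_residue v' v (shift_residue v v' u) = u.
Proof.
move=> N1 N'1 sN sN' /linkP[_ [i [b bo H]]] /H[c co ->].
by rewrite !shift_residueE //; have := sN i; have := sN' i;
  have := offsets_le bo; have := offsets_le co; lia.
Qed.

End CyclicComplex.

Lemma cyclic_complex_last_irrelevant m (a0 a1 a2 a3 a3' : 'I_m -> nat) N :
  cyclic_complex N a0 a1 a2 a3 = cyclic_complex N a0 a1 a2 a3'.
Proof. by apply/setP => s; apply/cyclic_complexP/cyclic_complexP. Qed.

Lemma cyclic_complex_vertex m (a0 a1 a2 a3 : 'I_m -> nat) N (i : 'I_m) (v : 'Z_N) :
  [set v] \in cyclic_complex N a0 a1 a2 a3.
Proof.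
by apply/cyclic_complexP; exists i, v => u /set1P->; exists 0%N; rewrite ?add0r.
Qed.

Lemma combinatorial_manifold_transfer m (R : realType) N N' (a0 a1 a2 a3 a3' : 'I_m -> nat) :
    (forall i, [/\ 0 < a0 i, 0 < a1 i & 0 < a2 i]) ->
    (forall i, 2 * (a0 i + a1 i + a2 i) < N) ->
    (forall i, 2 * (a0 i + a1 i + a2 i) < N') ->
  combinatorial_manifold R 3 (cyclic_complex N a0 a1 a2 a3) ->
  combinatorial_manifold R 3 (cyclic_complex N' a0 a1 a2 a3').
Proof.
(* Purity includes nonemptiness, and a face supplies an index [i]; the bounds at [i] give both
   moduli above 1, where ['Z_N] is the genuine cyclic group. *)
move=> a_gt0 sN sN' [_ [/set0Pn[s /cyclic_complexP[i _]] _] linkM].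
have N1 : 1 < N by have := sN i; have [] := a_gt0 i; lia.
have N'1 : 1 < N' by have := sN' i; have [] := a_gt0 i; lia.
rewrite (cyclic_complex_last_irrelevant _ _ _ _ a3); split.
- exact: cyclic_complex_closed.
- by apply: cyclic_complex_pure => // j; have := sN' j; lia.
move=> v' _; have := linkM 0%R (cyclic_complex_vertex _ _ _ _ i _).
apply: (pl_homeomorphic_iso (f := shift_residue 0%R v') (g := shift_residue v' 0%R)).
- by move=> t; apply: shift_residue_link.
- by move=> t; apply: shift_residue_link.
- by move=> t u; apply: shift_residueK.
- by move=> t u; apply: shift_residueK.
Qed.

Local Close Scope nat_scope.

(** * Continuity of PL maps *)

From mathcomp Require Import all_classical topology normedtype.
Import numFieldNormedType.Exports.

Local Open Scope classical_set_scope.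
Local Open Scope ring_scope.

Lemma cvg_sum (R : realType) (I T : Type) (F : set_system T) {FF : Filter F}
    (r : seq I) (f : I -> T -> R^o) (l : I -> R^o) :
  (forall i, f i x @[x --> F] --> l i) ->
  \sum_(i <- r) f i x @[x --> F] --> \sum_(i <- r) l i.
Proof.
move=> fl; apply: cvg_big => //; exact: add_continuous.
Qed.

Lemma cvg_dist_comb (R : realType) (V T : Type) (F : set_system T) {FF : Filter F}
    (s : seq V) (w : V -> T -> R^o) (l : V -> R^o) (c : V -> R^o) (a : R^o) :
  (forall v, w v u @[u --> F] --> l v) ->
  (`|\sum_(v <- s) w v u * c v - a| : R^o) @[u --> F] --> (`|\sum_(v <- s) l v * c v - a| : R^o).
Proof.
move=> wl; apply: cvg_norm; apply: cvgB; last exact: cvg_cst.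
by apply: cvg_sum => v; apply: cvgM; [exact: wl|exact: cvg_cst].
Qed.

(** The part of [C] where [Psi >= e] is compact, so its image under [Phi] is closed; it avoids 0 and
    therefore a neighbourhood of 0. *)
Lemma compact_lt_near0 (R : realType) (U : topologicalType) (C : set U)
    (Phi Psi : U -> R^o) (e : R) :
  compact C -> continuous Phi -> continuous Psi -> (forall u, 0 <= Phi u) ->
  (forall u, C u -> Phi u = 0 -> Psi u < e) ->
  exists2 d : R, 0 < d & forall u, C u -> Phi u < d -> Psi u < e.
Proof.
move=> Cc Phic Psic Phi0 H.
pose K := C `&` Psi @^-1` [set x | e <= x].
have Kc : compact K.
  apply: compact_closedI => //; apply: preimage_closed; last exact: closed_ge.
  by move=> w _; exact: Psic.
have PKc : closed (Phi @` K).
  apply: compact_closed; first exact: Rhausdorff.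
  by apply: continuous_compact => //; apply: continuous_subspaceT.
have PK0 : ~ (Phi @` K) 0.
  by move=> [w [Cw /= ePsi]] /(H _ Cw); rewrite ltNge ePsi.
have /= [d d0 Hd] : nbhs (0 : R^o) (~` (Phi @` K)).
  by apply: open_nbhs_nbhs; split=> //; rewrite openC.
exists d => // u Cu ud; rewrite ltNge; apply/negP => eu.
apply: (Hd (Phi u)); last by exists u.
by rewrite /= sub0r normrN ger0_norm.
Qed.

Lemma compact_comb (R : realType) (U : topologicalType) (C : set U) (V T : Type)
    (s : seq V) (r : seq T) (w : V -> U -> R^o) (c : V -> R^o) (x : T -> V -> R^o)
    (p : T -> R^o) (a e : R^o) :
  compact C -> (forall v, continuous (w v)) ->
  (forall u, C u -> \sum_(v <- s) w v u = 1 ->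
     \sum_(i <- r) `|\sum_(v <- s) w v u * x i v - p i| = 0 ->
     `|\sum_(v <- s) w v u * c v - a| < e) ->
  exists2 d : R, 0 < d & forall u, C u -> \sum_(v <- s) w v u = 1 ->
     \sum_(i <- r) `|\sum_(v <- s) w v u * x i v - p i| < d ->
     `|\sum_(v <- s) w v u * c v - a| < e.
Proof.
move=> Cc wc H.
pose Psi u : R^o := `|\sum_(v <- s) w v u * c v - a|.
(* The first summand measures the failure of the weights to sum to 1, so compactness of a cube of
   weights suffices in place of the simplex of barycentric weights. *)
pose Phi u : R^o := `|\sum_(v <- s) w v u * 1 - 1|
  + \sum_(i <- r) `|\sum_(v <- s) w v u * x i v - p i|.
have s1 u : \sum_(v <- s) w v u * 1 = \sum_(v <- s) w v u.
  by apply: eq_bigr => v _; rewrite mulr1.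
have [||||d d0 Hd] := @compact_lt_near0 R U C Phi Psi e Cc.
- move=> u; apply: cvgD; first by apply: cvg_dist_comb => v; exact: wc.
  by apply: cvg_sum => i; apply: cvg_dist_comb => v; exact: wc.
- by move=> u; apply: cvg_dist_comb => v; exact: wc.
- by move=> u; rewrite addr_ge0 ?sumr_ge0.
- move=> u Cu /eqP; rewrite paddr_eq0 ?sumr_ge0 // s1 normr_eq0 subr_eq0.
  by move=> /andP[/eqP u1 /eqP u0]; apply: H.
exists d => // u Cu u1 ud; apply: Hd => //.
by rewrite /Phi s1 u1 subrr normr0 add0r.
Qed.

Section CoordNbhs.

Variables (R : realType) (T : finType).
Implicit Types x y p : {ffun T -> R^o}.

(** The neighbourhood filter of the product topology, given as a bare filter so that limits within a
    polyhedron can be taken. *)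
Definition coord_nbhs x : set_system {ffun T -> R^o} :=
  [set P | exists2 d : R, 0 < d & forall y, (forall i, `|y i - x i| < d) -> P y].

Global Instance coord_nbhs_filter x : ProperFilter (coord_nbhs x).
Proof.
apply: Build_ProperFilter => [[d d0 H]|].
  by apply: (H x) => i; rewrite subrr normr0.
split=> [|P Q [d d0 Pd] [e e0 Qe]|P Q PQ [d d0 Pd]].
- by exists 1.
- exists (Num.min d e); first by rewrite lt_min d0.
  by move=> y yde; split; [apply: Pd|apply: Qe] => i; have := yde i; rewrite lt_min => /andP[].
- by exists d => // y /Pd/PQ.
Qed.

Lemma cvg_coord x i : (y : {ffun T -> R^o}) i @[y --> coord_nbhs x] --> x i.
Proof.
apply/cvgrPdistC_lt => e e0; exists e => // y ye; exact: ye.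
Qed.

Lemma cvg_coord_nbhs (U : Type) (F : set_system U) {FF : Filter F} (g : U -> {ffun T -> R^o}) x :
  (forall i, g u i @[u --> F] --> x i) -> g u @[u --> F] --> coord_nbhs x.
Proof.
move=> gx P [d d0 Pd].
have : \forall u \near F, forall i, `|g u i - x i| < d.
  by apply: filter_forall => i; move/cvgrPdistC_lt: (gx i); apply.
by apply: filterS => u /Pd.
Qed.

(** Weights are set to 0 off [s], which places them in the cube of all functions into [0, 1],
    compact by Tychonoff. *)
Lemma hull_bounded_weights (s : {fset {ffun T -> R^o}}) x : hull s x ->
  exists w : {ffun T -> R^o} -> R, [/\ forall v, 0 <= w v <= 1,
    \sum_(v <- s) w v = 1 & x = \sum_(v <- s) w v *: v].
Proof.
move=> [w [w0 w1] ->]; exists (fun v => if v \in s then w v else 0); split.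
- move=> v; case: ifP => vs; last by rewrite lexx ler01.
  rewrite w0 //= -w1 (big_fsetD1 v) //= lerDl big_seq.
  by apply: sumr_ge0 => u; rewrite !inE => /andP[_ /w0].
- by rewrite -w1; apply: eq_big_seq => v ->.
- by apply: eq_big_seq => v ->.
Qed.

(* Compactness of the set of barycentric weights makes the combinations
   [\sum_(v <- s) w v * c v] that are far from [F p] come from points far from [p]. *)
Lemma hull_affine_cvg (s : {fset {ffun T -> R^o}}) (c F : {ffun T -> R^o} -> R^o) p :
  (forall w, barycentric s w -> F (\sum_(v <- s) w v *: v) = \sum_(v <- s) w v * c v) ->
  F x @[x --> within (hull s) (coord_nbhs p)] --> F p.
Proof.
move=> Faff; apply/cvgrPdistC_lt => e e0.
have coordE w i : (\sum_(v <- s) w v *: v : {ffun T -> R^o}) i = \sum_(v <- s) w v * v i.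
  by rewrite sum_ffunE; apply: eq_bigr => v _; rewrite ffunE.
pose U := prod_topology (fun _ : {ffun T -> R^o} => R^o).
have cw (v : {ffun T -> R^o}) : continuous (fun w : U => (w v : R^o)).
  exact: proj_continuous.
have Cc := @tychonoff _ (fun _ : {ffun T -> R^o} => R^o : topologicalType)
  (fun=> [set` `[(0:R), 1]]) (fun=> @segment_compact R 0 1).
have [|d d0 Hd] := @compact_comb R U _ _ _ s (enum T) (fun v w => w v) c
    (fun i v => v i) p (F p) e Cc cw.
  move=> w Cw w1 /eqP; rewrite psumr_eq0 // => /allP wp.
  have bw : barycentric s w by split=> // v _; have := Cw v; rewrite /= in_itv /= => /andP[].
  have pE : \sum_(v <- s) w v *: v = p.
    apply/ffunP => i; rewrite coordE; apply/eqP.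
    by rewrite -subr_eq0 -normr_eq0; apply: wp; rewrite mem_enum.
  by rewrite -(Faff _ bw) pE subrr normr0.
(* One more than the number of coordinates: the total deviation stays strictly below [d], and [N] is
   nonzero even for empty [T]. *)
pose N : R := (size (enum T)).+1%:R.
have N0 : 0 < N by rewrite ltr0n.
exists (d / N); first by rewrite divr_gt0.
move=> x xp sx.
have [w [w01 w1 xE]] := hull_bounded_weights sx.
have bw : barycentric s w by split=> // v _; have /andP[] := w01 v.
rewrite xE (Faff _ bw); apply: Hd => //.
under eq_bigr do rewrite -coordE -xE.
apply: (@le_lt_trans _ _ (\sum_(i <- enum T) (d / N))).
  by apply: ler_sum => i _; apply/ltW/xp.
rewrite big_const_seq count_predT iter_addr_0 -mulr_natr mulrAC -mulrA gtr_pMr // ltr_pdivrMr //.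
by rewrite mul1r ltr_nat.
Qed.

End CoordNbhs.

(** The map is affine on each of the finitely many simplices of a subdivision, so finitely many
    neighbourhoods are intersected. Simplices that miss [p] are covered too: their hulls stay away
    from [p]. *)
Lemma pl_map_cvg (R : realType) (T T' : finType) (G : {fset {fset {ffun T -> R^o}}})
    (H : {fset {fset {ffun T' -> R^o}}}) f p u :
  pl_map G H f ->
  (f x u : R^o) @[x --> within (polyhedron G) (coord_nbhs p)] --> (f p u : R^o).
Proof.
move=> [G' [H' [[_ GG' _] _ fs]]]; apply/cvgrPdistC_lt => e e0.
have : \forall x \near coord_nbhs p, forall s : G', hull (val s) x -> `|f x u - f p u| < e.
  apply: filter_forall => s; have [_ fw] := fs _ (valP s).
  have := @hull_affine_cvg R T (val s) (fun v => f v u) (fun x => f x u) p.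
  move=> /(_ _)/cvgrPdistC_lt; apply => // w /fw ->.
  by rewrite sum_ffunE; apply: eq_bigr => v _; rewrite ffunE.
apply: filterS => x Hx /GG'[s sG' sx].
exact: (Hx [` sG']%fset).
Qed.

(** * Boundaries of simplices have no cut vertices *)

Lemma basis_vector_inj (R : realType) (T : finType) : injective (@basis_vector T R).
Proof.
move=> u v /ffunP/(_ u); rewrite !ffunE eqxx; case: eqP => // _ /eqP.
by rewrite oner_eq0.
Qed.

Lemma polyhedron_realizationP (R : realType) (T : finType) (K : {set {set T}})
    (x : {ffun T -> R^o}) :
  polyhedron (realization R K) x <->
  exists s : {set T}, [/\ s \in K, forall v, 0 <= x v, \sum_v x v = 1 &
    forall v, v \notin s -> x v = 0].
Proof.
have sumE (W : nmodType) (s : {set T}) (F : {ffun T -> R^o} -> W) :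
    \sum_(e <- [fset basis_vector R v | v in s]%fset) F e = \sum_(v in s) F (basis_vector R v).
  rewrite big_imfset /=; last by move=> u v _ _; exact: basis_vector_inj.
  by rewrite big_enum.
have coordE (s : {set T}) (w : T -> R) u :
    (\sum_(v in s) w v *: basis_vector R v) u = if u \in s then w u else 0.
  rewrite sum_ffunE; case: ifP => us.
    rewrite (bigD1 u) //= !ffunE eqxx big1 ?addr0 => [|v /andP[_ /negbTE vu]]; first exact: mulr1.
    by rewrite !ffunE eq_sym vu; exact: mulr0.
  rewrite big1 // => v vs; rewrite !ffunE; case: eqP => [uv|_]; last exact: mulr0.
  by rewrite uv vs in us.
split=> [[_ /imfsetP[s /= sK ->]] [w [w0 w1] ->]|[s [sK x0 x1 xs]]].
  rewrite !sumE in w1 *; exists s; split=> // [v||v vs]; rewrite ?coordE.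
  - case: ifP => // vs; apply: w0; by apply/imfsetP; exists v.
  - rewrite -w1; under eq_bigr do rewrite coordE.
    by rewrite -big_mkcond.
  - by rewrite (negbTE vs).
exists [fset basis_vector R v | v in s]%fset; first by apply/imfsetP; exists s.
(* Pairing with [x] reads off a coordinate at a basis vector, which yields a weight function on all
   vectors without inverting [basis_vector]. *)
have wE v : \sum_u x u * basis_vector R v u = x v.
  rewrite (bigD1 v) //= !ffunE eqxx mulr1 big1 ?addr0 // => u /negbTE uv.
  by rewrite !ffunE uv mulr0.
exists (fun e : {ffun T -> R^o} => \sum_u x u * e u).
  split=> [_ /imfsetP[v /= _ ->]|]; first by rewrite wE.
  rewrite sumE; under eq_bigr do rewrite wE.
  rewrite -x1 [RHS](bigID (mem s)) /= [X in _ + X]big1 ?addr0 //.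
rewrite sumE; under eq_bigr do rewrite wE.
by apply/ffunP => u; rewrite coordE; case: ifPn => // /xs.
Qed.

Lemma polyhedron_boundaryP (R : realType) d (x : {ffun 'I_d.+1 -> R^o}) :
  polyhedron (realization R (simplex_boundary d)) x <->
  [/\ forall i, 0 <= x i, \sum_i x i = 1 & exists i, x i = 0].
Proof.
split=> [/polyhedron_realizationP[s [+ x0 x1 xs]]|[x0 x1 [i xi]]].
  rewrite inE => /fintype.properP[_ [i _ is']]; split=> //; exists i; exact: xs.
apply/polyhedron_realizationP; exists [set~ i]%SET; split=> //.
  rewrite inE; apply/fintype.properP; split; first exact: finset.subsetT.
  by exists i; rewrite !inE ?eqxx.
by move=> v; rewrite !inE negbK => /eqP->.
Qed.

Lemma scaleRo (R : pzRingType) (t : R) (a : R^o) : t *: a = t * a.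
Proof. by []. Qed.

(** * Signs of continuous functions near a point of the simplex boundary *)

Section Sign.

Variables (R : realType) (T : finType).
Implicit Types (x y z : {ffun T -> R^o}).

(** Intermediate value theorem along the segment from [y] to [z]. *)
Lemma convex_sign (D : set {ffun T -> R^o}) (phi : {ffun T -> R^o} -> R^o) :
  (forall y z (t : R), D y -> D z -> 0 <= t <= 1 -> D (y + t *: (z - y))) ->
  (forall x, D x -> phi x @[x --> coord_nbhs x] --> phi x) ->
  (forall x, D x -> phi x != 0) ->
  forall y z, D y -> D z -> 0 < phi y -> 0 < phi z.
Proof.
move=> Dconv phic phi0 y z Dy Dz y0; rewrite ltNge; apply/negP => z0.
pose seg (t : R) : {ffun T -> R^o} := y + t *: (z - y).
have Dseg t : t \in `[0, 1] -> D (seg t) by rewrite in_itv /=; apply: Dconv.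
have seg0 : seg 0 = y by rewrite /seg scale0r addr0.
have seg1 : seg 1 = z by rewrite /seg scale1r addrC subrK.
have cseg t i : seg s i @[s --> t] --> (seg t i : R^o).
  have E s : seg s i = y i + s * (z i - y i) by rewrite !ffunE.
  under eq_cvg do rewrite E.
  rewrite E; apply: cvgD; first exact: cvg_cst.
  by apply: cvgMr_tmp; exact: cvg_id.
have cont : {within `[0, 1], continuous (phi \o seg : R -> R)}.
  apply: continuous_in_subspaceT => t; rewrite inE => /Dseg Dt.
  apply: cvg_comp (phic _ Dt); apply: cvg_coord_nbhs => i; exact: cseg.
have [|t t01 t0] := @IVT R (phi \o seg) 0 1 0 ler01 cont.
  by rewrite /= seg0 seg1 ge_min le_max z0 (ltW y0) orbT.
by move/eqP: t0; apply/negP; exact: phi0 (Dseg _ t01).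
Qed.

End Sign.

Section Retraction.

Variables (R : realType) (d : nat).
Implicit Types (x y z q : {ffun 'I_d.+1 -> R^o}).

Definition min_coord x : R := x [arg min_(i < ord0) (x i : R)]%O.

Lemma min_coord_le x i : min_coord x <= x i.
Proof. by rewrite /min_coord; case: arg_minP => // j _; apply. Qed.

(** Translation along (1, ..., 1) until the least coordinate is 0, then radial scaling to total 1.
    This retracts the complement of the diagonal onto the boundary of the simplex. *)
Definition bd_retract x : {ffun 'I_d.+1 -> R^o} :=
  [ffun i => (x i - min_coord x) / \sum_j (x j - min_coord x)].

(** The hypothesis [x j < x i] serves from here on as an open certificate that [x] is off the
    diagonal. *)
Lemma spread_gt0 x i j : x j < x i -> 0 < \sum_k (x k - min_coord x).
Proof.
move=> xij; rewrite (bigD1 i) //= ltr_pwDl ?sumr_ge0 // => [|k _].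
  by rewrite subr_gt0; apply: le_lt_trans xij; exact: min_coord_le.
by rewrite subr_ge0 min_coord_le.
Qed.

Lemma bd_retract_boundary x i j : x j < x i ->
  polyhedron (realization R (simplex_boundary d)) (bd_retract x).
Proof.
move=> /spread_gt0 s0; apply/polyhedron_boundaryP; split.
- by move=> k; rewrite ffunE divr_ge0 ?(ltW s0) // subr_ge0 min_coord_le.
- under eq_bigr do rewrite ffunE.
  by rewrite -mulr_suml mulfV // gt_eqF.
- by exists [arg min_(i < ord0) (x i : R)]%O; rewrite ffunE subrr mul0r.
Qed.

Lemma bd_retract_id q : polyhedron (realization R (simplex_boundary d)) q ->
  bd_retract q = q.
Proof.
move=> /polyhedron_boundaryP[q0 q1 [i qi]].
have m0 : min_coord q = 0.
  by apply/eqP; rewrite eq_le -{1}qi min_coord_le /min_coord q0.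
apply/ffunP => j; rewrite ffunE m0; under eq_bigr do rewrite subr0.
by rewrite q1 subr0 divr1.
Qed.

Lemma cvg_min_coord x : (min_coord y : R^o) @[y --> coord_nbhs x] --> (min_coord x : R^o).
Proof.
apply/cvgrPdistC_lt => e e0; exists e => // y ye.
rewrite ltr_norml; apply/andP; split.
  have := ye [arg min_(i < ord0) (y i : R)]%O; rewrite ltr_norml => /andP[+ _].
  rewrite -/(min_coord y); have := min_coord_le x [arg min_(i < ord0) (y i : R)]%O.
  by rewrite -/(min_coord y); lra.
have := ye [arg min_(i < ord0) (x i : R)]%O; rewrite ltr_norml => /andP[_].
have := min_coord_le y [arg min_(i < ord0) (x i : R)]%O.
by rewrite -/(min_coord x); lra.
Qed.

Lemma cvg_bd_retract x i j : x j < x i ->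
  bd_retract y @[y --> coord_nbhs x] -->
  within (polyhedron (realization R (simplex_boundary d))) (coord_nbhs (bd_retract x)).
Proof.
move=> xij.
have ret : bd_retract y @[y --> coord_nbhs x] --> coord_nbhs (bd_retract x).
  apply: cvg_coord_nbhs => k; under eq_cvg do rewrite ffunE.
  rewrite ffunE; apply: cvgM.
    by apply: cvgB; [exact: cvg_coord|exact: cvg_min_coord].
  apply: cvgV; first by rewrite gt_eqF // (spread_gt0 xij).
  by apply: cvg_sum => l; apply: cvgB; [exact: cvg_coord|exact: cvg_min_coord].
have near_lt : \forall y \near coord_nbhs x, (y : {ffun 'I_d.+1 -> R^o}) j < y i.
  have e0 : 0 < (x i - x j) / 2 by rewrite divr_gt0 // subr_gt0.
  exists ((x i - x j) / 2) => // y xy.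
  by have := xy i; have := xy j; rewrite !ltr_norml => /andP[? ?] /andP[? ?]; lra.
move=> P; rewrite /within /= => /ret; apply: filterS2 near_lt => y yij; apply.
exact: bd_retract_boundary yij.
Qed.

End Retraction.

(* The retraction takes the value [q] only on the plane spanned by [q] and
   (1, ..., 1), whose codimension is at least 2: the complement of the plane is
   covered by the open half-spaces [0 < +-pi k], and near [q] any two of them are
   linked by a chain of half-spaces that meet successively. *)
Lemma boundary_punctured_sign (R : realType) d (q : {ffun 'I_d.+1 -> R^o})
    (h : {ffun 'I_d.+1 -> R^o} -> R^o) :
  let bd := polyhedron (realization R (simplex_boundary d)) in
  (2 < d)%N -> bd q ->
  (forall p, bd p -> h x @[x --> within bd (coord_nbhs p)] --> h p) ->
  (\forall p \near coord_nbhs q, bd p -> p != q -> h p != 0) ->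
  exists2 e : R, 0 < e & forall p p', bd p -> bd p' ->
    (forall i, `|p i - q i| < e) -> (forall i, `|p' i - q i| < e) ->
    p != q -> p' != q -> 0 < h p -> 0 < h p'.
Proof.
move=> bd d2 bdq hc hn0.
have /polyhedron_boundaryP[q0 q1 [j qj]] := bdq.
have [i qi] : exists i, 0 < q i.
  apply: contrapT => /forallNP H; have : \sum_i q i <= 0.
    by apply: sumr_le0 => k _; rewrite leNgt; apply/negP/H.
  by rewrite q1 ler10.
have qji : q j < q i by rewrite qj.
have [e1 e10 He1] : \forall x \near coord_nbhs q,
    bd_retract x != q -> h (bd_retract x) != 0.
  have := cvg_bd_retract qji; rewrite (bd_retract_id bdq).
  by move=> /(_ [set p | p != q -> h p != 0]); apply.
(* As [q j = 0], the bound [q i / 2] keeps coordinate [j] below coordinate [i] throughout the box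
   [B]. *)
pose e := Num.min e1 (q i / 2).
have e0 : 0 < e by rewrite lt_min e10 divr_gt0.
have ee1 : e <= e1 by rewrite ge_min lexx.
have eqi : e <= q i / 2 by rewrite ge_min lexx orbT.
pose B := [set x : {ffun 'I_d.+1 -> R^o} | forall l, `|x l - q l| < e].
have Bji x : B x -> x j < x i.
  move=> Bx; have := Bx i; have := Bx j; rewrite qj !ltr_norml => /andP[? ?] /andP[? ?].
  by move: eqi; lra.
(* As [q j = 0], these linear forms vanish at [q] and at (1, ..., 1); those with [k] different from
   [i] and [j] cut out the plane spanned by the two. *)
pose pi k (x : {ffun 'I_d.+1 -> R^o}) : R := (x k - x j) * q i - (x i - x j) * q k.
have pi_ret x k : B x -> bd_retract x = q -> pi k x = 0.
  move=> Bx xq; have S0 := spread_gt0 (Bji _ Bx).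
  set S := \sum_k _ in S0.
  have xE l : x l = S * q l + min_coord x.
    by rewrite -xq ffunE -/S mulrC divfK ?gt_eqF // subrK.
  by rewrite /pi !xE qj; ring.
pose phi x := h (bd_retract x).
pose D k (b : bool) := [set x | B x /\ 0 < (-1) ^+ b * pi k x].
have phi0 k b x : D k b x -> phi x != 0.
  move=> [Bx Dx]; have bdx := bd_retract_boundary (Bji _ Bx).
  apply: He1 => // [l|]; first exact: lt_le_trans (Bx l) ee1.
  by apply: contraTneq Dx => /(pi_ret _ k Bx) ->; rewrite mulr0 ltxx.
have conv (t a c : R) : 0 <= t <= 1 -> 0 < a -> 0 < c -> 0 < (1 - t) * a + t * c.
  move=> /andP[t0 t1] a0 c0; have [->|tn0] := eqVneq t 0; first by rewrite subr0 mul1r mul0r addr0.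
  by rewrite ltr_wpDl ?mulr_gt0 ?mulr_ge0 ?subr_ge0 ?(ltW a0) // lt_neqAle eq_sym tn0.
have signD k b y z : D k b y -> D k b z -> 0 < phi y -> 0 < phi z.
  apply: convex_sign; last exact: phi0.
    move=> {}y {}z t [By Dy] [Bz Dz] t01; split.
      move=> l; rewrite !ffunE; have := By l; have := Bz l.
      rewrite !ltr_norml => /andP[z1 z2] /andP[y1 y2].
      rewrite -subr_gt0 in z1; rewrite -subr_gt0 in z2.
      rewrite -subr_gt0 in y1; rewrite -subr_gt0 in y2.
      have := conv _ _ _ t01 y1 z1; have := conv _ _ _ t01 y2 z2.
      by rewrite scaleRo => ? ?; apply/andP; split; lra.
    have -> : (-1) ^+ b * pi k (y + t *: (z - y)) =
        (1 - t) * ((-1) ^+ b * pi k y) + t * ((-1) ^+ b * pi k z).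
      by rewrite /pi !ffunE !scaleRo; ring.
    exact: conv.
  move=> x [Bx _]; apply: cvg_comp (cvg_bd_retract (Bji _ Bx)) _.
  exact: hc (bd_retract_boundary (Bji _ Bx)).
(* The point [q] moved by [e / 2] in the directions [k] and [l] with prescribed signs: a common
   point of the half-spaces [D k b] and [D l b']. *)
pose c k (b : bool) l (b' : bool) : {ffun 'I_d.+1 -> R^o} :=
  [ffun u => q u + e / 2 * ((-1) ^+ b * (u == k)%:R + (-1) ^+ b' * (u == l)%:R)].
have cD k b l b' : k != l -> k != i -> k != j -> l != i -> l != j ->
    D k b (c k b l b') /\ D l b' (c k b l b').
  move=> kl ki kj li lj.
  have Bc : B (c k b l b').
    move=> u; rewrite ffunE addrC addKr normrM ger0_norm ?divr_ge0 ?(ltW e0) //.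
    have [->|uk] := eqVneq u k; first rewrite (negbTE kl) mulr0 addr0 mulr1 normrX normrN1 expr1n.
      by lra.
    rewrite mulr0 add0r normrM normrX normrN1 expr1n mul1r normr_nat.
    by case: eqP => _ /=; rewrite ?mulr1 ?mulr0 //; lra.
  have [ik jk] : (i == k) = false /\ (j == k) = false.
    by rewrite ![_ == k]eq_sym (negbTE ki) (negbTE kj).
  have [il jl] : (i == l) = false /\ (j == l) = false.
    by rewrite ![_ == l]eq_sym (negbTE li) (negbTE lj).
  have lk : (l == k) = false by rewrite eq_sym (negbTE kl).
  have pik : pi k (c k b l b') = e / 2 * (-1) ^+ b * q i.
    by rewrite /pi !ffunE eqxx (negbTE kl) ik jk il jl qj /= mulr0n mulr1n; ring.
  have pil : pi l (c k b l b') = e / 2 * (-1) ^+ b' * q i.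
    by rewrite /pi !ffunE eqxx lk ik jk il jl qj /= mulr0n mulr1n; ring.
  split; split=> //; rewrite ?pik ?pil.
    by rewrite [X in _ * X]mulrAC mulrCA -expr2 sqrr_sign mulr1 mulr_gt0 ?divr_gt0.
  by rewrite [X in _ * X]mulrAC mulrCA -expr2 sqrr_sign mulr1 mulr_gt0 ?divr_gt0.
have cross k b l b' y z : k != l -> k != i -> k != j -> l != i -> l != j ->
    D k b y -> D l b' z -> 0 < phi y -> 0 < phi z.
  move=> kl ki kj li lj Dy Dz y0; have [Dk Dl] := cD k b l b' kl ki kj li lj.
  exact: signD Dl Dz (signD _ _ _ _ Dy Dk y0).
have bdD p : bd p -> B p -> p != q -> exists k b, [/\ k != i, k != j & D k b p].
  move=> bdp Bp pq; have [k pk] : exists k, pi k p != 0.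
    apply: contrapT => /forallNP H; case/eqP: pq.
    (* If all forms vanish, [p] is [r * q] shifted by the constant [p j]. A zero coordinate of [p]
       forces [p j = 0], and total weight 1 forces [r = 1]. *)
    have pi0 k : pi k p = 0 by apply/eqP; apply: contrapT => /negP; apply: H.
    have pji := Bji _ Bp; pose r := (p i - p j) / q i.
    have r0 : 0 < r by rewrite divr_gt0 ?subr_gt0.
    have pE k : p k = p j + r * q k.
      apply: (mulIf (lt0r_neq0 qi)); rewrite mulrDl /r mulrAC divfK ?lt0r_neq0 //.
      by have := pi0 k; rewrite /pi; lra.
    have /polyhedron_boundaryP[p0 p1 [l pl]] := bdp.
    have pj : p j = 0.
      apply/eqP; rewrite eq_le p0 -pl (pE l) lerDl mulr_ge0 ?(ltW r0) //.
    have r1 : r = 1.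
      move: p1; under eq_bigr do rewrite pE pj add0r.
      by rewrite -mulr_sumr q1 mulr1.
    by apply/ffunP => k; rewrite pE pj r1 add0r mul1r.
  exists k, (pi k p < 0); split.
  - by apply: contraNneq pk => ->; rewrite /pi; apply/eqP; ring.
  - by apply: contraNneq pk => ->; rewrite /pi qj; apply/eqP; ring.
  - by split=> //; rewrite -normrEsign normr_gt0.
exists e => // p p' bdp bdp' Bp Bp' pq p'q.
have [k [b [ki kj Dp]]] := bdD p bdp Bp pq.
have [k' [b' [k'i k'j Dp']]] := bdD p' bdp' Bp' p'q.
suff : 0 < phi p -> 0 < phi p' by rewrite /phi !bd_retract_id.
have [kk'|] := eqVneq k k'; last by move=> kk'; apply: cross Dp Dp'.
subst k'.
(* Opposite half-spaces of one form are disjoint; [2 < d] provides a further index [l], whose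
   half-space meets both. *)
have [l] : exists l, l \notin [:: i; j; k].
  apply: contrapT => /forallNP H.
  suff : (#|'I_d.+1| <= size [:: i; j; k])%N by rewrite card_ord leqNgt /= ltnS d2.
  apply: leq_trans (card_size _); apply: subset_leq_card; apply/fintype.subsetP => l _.
  by apply: contrapT => /negP; apply: H.
rewrite !inE !negb_or => /and3P[li lj lk].
have kl : k != l by rewrite eq_sym.
have [_ Dl] := cD k b l true kl ki kj li lj.
by move=> /(cross _ _ _ _ _ _ kl ki kj li lj Dp Dl); apply: cross Dl Dp'.
Qed.

Section EdgePoint.

Variables (R : realType) (T : finType) (w y : T).

Definition edge_point (t : R) : {ffun T -> R^o} :=
  [ffun u => (1 - t) * (u == w)%:R + t * (u == y)%:R].

Lemma sum_edge_point t (C : {set T}) : w \notin C ->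
  \sum_(u <- enum C) edge_point t u = t * (y \in C)%:R.
Proof.
move=> wC; rewrite big_enum /=; have [yC|yC] := boolP (y \in C).
  rewrite (bigD1 y) //= big1 ?addr0 => [|u /andP[uC /negbTE uy]].
    rewrite ffunE eqxx; case: eqP => [yw|_]; first by rewrite -yw yC in wC.
    by rewrite mulr0 add0r.
  by rewrite ffunE uy; case: eqP => [uw|_]; [rewrite -uw uC in wC|rewrite !mulr0 addr0].
rewrite big1 ?mulr0 // => u uC; rewrite ffunE.
case: eqP => [uw|_]; first by rewrite -uw uC in wC.
by case: eqP => [uy|_]; [rewrite -uy uC in yC|rewrite !mulr0 addr0].
Qed.

Lemma polyhedron_edge_point (L : {set {set T}}) t : w != y -> 0 <= t <= 1 ->
  [set w; y]%SET \in L -> polyhedron (realization R L) (edge_point t).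
Proof.
move=> wy /andP[t0 t1] wyL; apply/polyhedron_realizationP.
exists [set w; y]%SET; split=> // [v||v].
- by rewrite ffunE addr_ge0 // mulr_ge0 ?ler0n ?subr_ge0.
- rewrite (bigD1 w) //= (bigD1 y) 1?eq_sym //= big1 ?addr0 => [|u /andP[/negbTE uw /negbTE uy]].
    by rewrite !ffunE !eqxx (negbTE wy) eq_sym (negbTE wy) !mulr0 !mulr1 add0r addr0 subrK.
  by rewrite ffunE uw uy !mulr0 addr0.
- by rewrite !inE negb_or ffunE => /andP[/negbTE-> /negbTE->]; rewrite !mulr0 addr0.
Qed.

Lemma edge_point_dist t u : w != y -> 0 <= t -> `|edge_point t u - edge_point 0 u| <= t.
Proof.
move=> wy t0; rewrite !ffunE ler_norml.
have [->|uw] := eqVneq u w; rewrite ?(negbTE wy); first by rewrite /=; apply/andP; split; lra.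
by case: (u == y) => /=; apply/andP; split; lra.
Qed.

End EdgePoint.

(** Let [h] be the weight of [g p] on [A] minus its weight on [B]. Near [w] every face lies on one
    side, so [h] can vanish only if both weights do, that is at [w]. It is positive on the edge to
    [y] and negative on the edge to [z], against [boundary_punctured_sign]. *)
Theorem boundary_no_cut_vertex (R : realType) (T : finType) (L : {set {set T}})
    (d : nat) (w y z : T) (A B : {set T}) :
  (2 < d)%N -> w \notin A -> w \notin B -> {in A, forall u, u \notin B} ->
  (forall s : {set T}, s \in L -> w \in s ->
     s \subset (w |: A)%SET \/ s \subset (w |: B)%SET) ->
  y \in A -> [set w; y]%SET \in L -> z \in B -> [set w; z]%SET \in L ->
  ~ pl_homeomorphic (realization R L) (realization R (simplex_boundary d)).
Proof.
move=> d2 wA wB AB star yA wyL zB wzL [f [g [plf plg gf fg]]].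
have wy : w != y by apply: contraNneq wA => ->.
have wz : w != z by apply: contraNneq wB => ->.
have yB := AB y yA.
have BA : {in B, forall u, u \notin A} by move=> u uB; apply: contraL uB; apply: AB.
have zA := BA z zB.
pose ew := edge_point w y (0 : R).
have ewz : edge_point w z (0 : R) = ew by apply/ffunP => u; rewrite !ffunE !mul0r.
have ew1 : ew w = 1 by rewrite ffunE eqxx subr0 mul0r addr0 mulr1.
have Lew : polyhedron (realization R L) ew.
  by apply: polyhedron_edge_point => //; rewrite lexx ler01.
pose bd := polyhedron (realization R (simplex_boundary d)).
pose q := f ew.
have bdq : bd q := pl_map_polyhedron plf Lew.
have gq : g q = ew by exact: gf.
pose h p : R^o := \sum_(u <- enum A) g p u - \sum_(u <- enum B) g p u.
have hc p : bd p -> h x @[x --> within bd (coord_nbhs p)] --> h p.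
  by move=> _; apply: cvgB; apply: cvg_sum => u; apply: pl_map_cvg plg.
have hn0 : \forall p \near coord_nbhs q, bd p -> p != q -> h p != 0.
  (* Positivity of the [w]-coordinate forces [w] into the face carrying [g p], so that [star]
     applies to this face. *)
  have gw0 : \forall p \near coord_nbhs q, bd p -> 0 < g p w.
    have /cvgrPdistC_lt H := @pl_map_cvg R _ _ _ _ g q w plg.
    move: (H 1 ltr01); apply: filterS => p.
    by rewrite gq ew1 ltr_norml ltrBrDr addNr => /andP[].
  apply: filterS gw0 => p gw0 bdp; apply: contraNneq => h0.
  have /polyhedron_realizationP[s [sL x0 x1 xs]] := pl_map_polyhedron plg bdp.
  have ws : w \in s by apply: contraT => /xs E; move: (gw0 bdp); rewrite E ltxx.
  have sum0 (C C' : {set T}) : w \notin C' -> {in C, forall u, u \notin C'} ->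
      s \subset (w |: C)%SET ->
      \sum_(u <- enum C') g p u = 0.
    move=> wC' CC' /fintype.subsetP sC; rewrite big_enum big1 //= => u uC'; apply: xs.
    apply/negP => /sC /finset.setU1P[uw|uC]; first by rewrite -uw uC' in wC'.
    by have := CC' u uC; rewrite uC'.
  have eqw (C : {set T}) : s \subset (w |: C)%SET -> \sum_(u <- enum C) g p u = 0 -> p = q.
    move=> /fintype.subsetP sC /eqP; rewrite big_enum psumr_eq0 //= => /allP C0.
    have gpu u : u != w -> g p u = 0.
      move=> uw; have [/sC|/xs //] := boolP (u \in s).
      move=> /finset.setU1P[uE|uC]; first by rewrite uE eqxx in uw.
      by apply/eqP; have := C0 u (mem_index_enum u); rewrite uC.
    rewrite -(fg p bdp) /q; congr f; apply/ffunP => u; rewrite ffunE subr0 mul1r mul0r addr0.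
    have [->|/gpu//] := eqVneq u w.
    by rewrite -x1 (bigD1 w) //= big1 ?addr0 // => v /gpu.
  apply/eqP; case: (star s sL ws) => sub.
    have B0 := sum0 _ _ wB AB sub; apply: (eqw _ sub).
    by move: h0; rewrite /h B0 subr0.
  have A0 := sum0 _ _ wA BA sub; apply: (eqw _ sub).
  by move/eqP: h0; rewrite /h A0 sub0r oppr_eq0 => /eqP.
have [e e0 He] := boundary_punctured_sign d2 bdq hc hn0.
have : f x @[x --> within (polyhedron (realization R L)) (coord_nbhs ew)] --> coord_nbhs q.
  by apply: cvg_coord_nbhs => i; apply: pl_map_cvg plf.
move=> /(_ [set p | forall i, `|p i - q i| < e]) [|c c0 Hc]; first by exists e.
pose t := Num.min (c / 2) 1.
have t0 : 0 < t by rewrite lt_min ltr01 divr_gt0.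
have t1 : t <= 1 by rewrite ge_min lexx orbT.
have tc : t < c by apply: (@le_lt_trans _ _ (c / 2)); [rewrite ge_min lexx|lra].
have t01 : 0 <= t <= 1 by rewrite ltW.
have Ly := polyhedron_edge_point wy t01 wyL.
have Lz := polyhedron_edge_point wz t01 wzL.
have neq v : w != v -> polyhedron (realization R L) (edge_point w v t) ->
    f (edge_point w v t) != q.
  move=> wv Lv; apply/eqP => E; have := congr1 g E.
  rewrite gq gf // => /ffunP/(_ w); rewrite ew1 ffunE eqxx (negbTE wv).
  by rewrite mulr1 mulr0 addr0 => /eqP; rewrite subr_eq -subr_eq0 opprD addNKr oppr_eq0 gt_eqF.
have := He _ _ (pl_map_polyhedron plf Ly) (pl_map_polyhedron plf Lz) _ _
  (neq _ wy Ly) (neq _ wz Lz).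
rewrite /h !gf // !sum_edge_point // yA zB (negbTE yB) (negbTE zA) mulr1 mulr0 subr0 sub0r oppr_gt0.
move=> /(_ _ _ t0); rewrite ltNge (ltW t0) => H.
suff : false by [].
apply: H.
  by apply: Hc => // i; apply: le_lt_trans tc; apply: edge_point_dist => //; exact: ltW.
by apply: Hc => // i; apply: le_lt_trans tc; rewrite -ewz; apply: edge_point_dist => //; exact: ltW.
Qed.

(* The pinched link and the characterisation *)
Local Close Scope ring_scope.
Local Open Scope nat_scope.

Lemma antipodal_vertex_pinched (R : realType) m N (a0 a1 a2 a3 : 'I_m -> nat) i0 :
    (forall i, [/\ 0 < a0 i, 0 < a1 i & 0 < a2 i]) ->
    N = 2 * (a0 i0 + a1 i0 + a2 i0) ->
    (forall i, a0 i + a1 i + a2 i <= a0 i0 + a1 i0 + a2 i0) ->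
  ~ combinatorial_manifold R 3 (cyclic_complex N a0 a1 a2 a3).
Proof.
set s0 := a0 i0 + a1 i0 + a2 i0 => a_gt0 NE smax [_ _ /(_ _ (cyclic_complex_vertex _ _ _ _ i0 0%R))].
have s00 : 0 < a0 i0 < s0 by have [] := a_gt0 i0; lia.
have N1 : 1 < N by lia.
have nb e : e < N -> nat_of_ord (e%:R : 'Z_N)%R = e.
  by move=> eN; rewrite /= val_Zp_nat // modn_small.
have ws0 := nb s0; have wa := nb (a0 i0); have wb := nb (s0 + a0 i0).
have N0 : (N%:R = 0 :> 'Z_N)%R by apply: val_inj; rewrite /= val_Zp_nat // modnn.
have s0N : (s0%:R = - s0%:R :> 'Z_N)%R.
  by apply/eqP; rewrite -addr_eq0 -natrD addnn -mul2n -NE N0.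
have neq0 c : c < N -> 0 < c -> (c%:R : 'Z_N)%R != 0%R.
  by move=> cN c0; apply/eqP => /(@Zp_nat_inj N c 0 cN); lia.
(* The two open arcs into which 0 and N/2 divide the cycle. *)
pose A := [set u : 'Z_N | 0 < u < s0]%SET; pose B := [set u : 'Z_N | s0 < u]%SET.
apply: (@boundary_no_cut_vertex R _ _ 3 (s0%:R)%R (a0 i0)%:R%R (s0 + a0 i0)%:R%R A B) => //.
- rewrite inE ws0; lia.
- rewrite inE ws0; lia.
- by move=> u; rewrite !inE; lia.
- move=> s /linkP[s'0 [i [b bo H]]] ws.
  have [c co wE] := H _ ws; rewrite add0r in wE.
  have bs := leq_trans (offsets_le bo) (smax i); have cs := leq_trans (offsets_le co) (smax i).
  have /(congr1 (@nat_of_ord _)) : (c%:R = (s0 + b)%:R :> 'Z_N)%R by rewrite natrD wE subrK.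
  rewrite nb; last by lia.
  rewrite /= val_Zp_nat // => cE.
  (* Both offsets are at most [s0 = N/2] and [c] is congruent to [s0 + b]: without wrap-around
     [b = 0], with it [b = s0]. The simplex then spans [0, N/2] or [N/2, N] respectively. *)
  have [[b0 cs0]|[bs0 c0]] : b = 0 /\ c = s0 \/ b = s0 /\ c = 0.
    have [E|E] := ltnP (s0 + b) N.
      by rewrite modn_small // in cE; left; lia.
    have bE : s0 + b = N by lia.
    by rewrite bE modnn in cE; right; lia.
  - left; apply/fintype.subsetP => u us; have [e eo uE] := H u us.
    have es := leq_trans (offsets_le eo) (smax i).
    rewrite b0 subr0 add0r in uE.
    have e0 : e != 0 by apply: contraNneq s'0 => e0; rewrite e0 in uE; rewrite -[0%R]uE.
    rewrite uE !inE nb; last by lia.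
    have [->|es0] := eqVneq e s0; rewrite ?eqxx //; lia.
  - right; apply/fintype.subsetP => u us; have [e eo uE] := H u us.
    have es := leq_trans (offsets_le eo) (smax i).
    rewrite bs0 add0r -s0N -natrD in uE.
    have [e0|e0] := eqVneq e 0; first by rewrite uE e0 add0n !inE eqxx.
    have es0 : e != s0.
      by apply: contraNneq s'0 => es0; rewrite uE es0 addnn -mul2n -NE N0 in us.
    by rewrite uE !inE nb; lia.
- by rewrite inE wa; lia.
- apply/linkP; split.
    by rewrite !inE negb_or ![0%R == _]eq_sym !neq0; lia.
  exists i0, 0; first by rewrite inE.
  move=> u; rewrite !inE => /orP[]/eqP->; [exists s0|exists (a0 i0)];
    by rewrite ?inE ?eqxx ?orbT // add0r subr0.
- by rewrite inE wb; lia.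
apply/linkP; split.
  by rewrite !inE negb_or ![0%R == _]eq_sym !neq0; lia.
(* With the vertex 0 at the last offset, the offset 0 lands at [-s0 = s0] and [a0 i0] lands at
   [s0 + a0 i0], in the arc [B]. *)
exists i0, s0; first by rewrite !inE eqxx ?orbT.
move=> u; rewrite !inE => /orP[]/eqP->; [exists 0|exists (a0 i0)];
  by rewrite ?inE ?eqxx ?orbT // add0r -s0N ?natrD // ?add0r // addrC.
Qed.

Theorem theorem3p1 (R : realType) (m n : nat) (a0 a1 a2 a3 : 'I_m -> nat)
  (a_gt0 : forall i, [&& 0 < a0 i, 0 < a1 i, 0 < a2 i & 0 < a3 i])
  (a_sum : forall i, a0 i + a1 i + a2 i + a3 i = n)
  (a3_max : forall i, [&& a0 i <= a3 i, a1 i <= a3 i & a2 i <= a3 i])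
  (M_manifold : combinatorial_manifold R 3 (cyclic_complex n a0 a1 a2 a3)) :
  (forall k : nat,
     combinatorial_manifold R 3
       (cyclic_complex (n + k) a0 a1 a2 (fun i => a3 i + k))) <->
  (forall i, a0 i + a1 i + a2 i < a3 i).
Proof.
have a_pos i : [/\ 0 < a0 i, 0 < a1 i & 0 < a2 i] by case/and4P: (a_gt0 i).
split=> [Mk i|a3_gt k]; last first.
  by apply: combinatorial_manifold_transfer M_manifold => // i; have := a_sum i; have := a3_gt i; lia.
rewrite ltnNge; apply/negP => a3_le.
pose s j := a0 j + a1 j + a2 j.
have [i0 _ smax] : {i0 | true & forall j, s j <= s i0}.
  by case: (@arg_maxnP _ i xpredT s) => // i0 _ H; exists i0 => // j; exact: H.
(* The truncated subtraction is exact: the violated inequality at [i] gives [n <= 2 * s i], and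
   [s i <= s i0]. *)
apply: (@antipodal_vertex_pinched R m _ a0 a1 a2 _ i0 a_pos _ smax (Mk (2 * s i0 - n))).
by have := smax i; have := a_sum i; rewrite /s; lia.
Qed.
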